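(* Let $S$ be a regular LA-semigroup. For every ideal $P$ of $S$, $P$ is prime if and only if $P$ is strongly irreducible.
   Context: An LA-semigroup (left almost semigroup) is a set $S$ with a binary operation satisfying the left invertive law $(ab)c=(cb)a$ for all $a,b,c\in S$ (the operation is not assumed associative). $S$ is regular if for each $a\in S$ there exists $x\in S$ such that $a=(ax)a$. For subsets $A,B\subseteq S$, $AB=\{ab: a\in A, b\in B\}$. A subset $I\subseteq S$ is a right (left) ideal if $IS\subseteq I$ ($SI\subseteq I$), and an ideal if it is both. An ideal $P$ of $S$ is prime if for all ideals $A,B$ of $S$, $AB\subseteq P$ implies $A\subseteq P$ or $B\subseteq P$. An ideal $I$ is strongly irreducible if for all ideals $H,K$ of $S$, $H\cap K\subseteq I$ implies $H\subseteq I$ or $K\subseteq I$. *)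

(* Defs.v *)
From mathcomp Require Import all_boot classical_sets.

Set Implicit Arguments.
Unset Strict Implicit.
Unset Printing Implicit Defensive.

Local Open Scope classical_set_scope.

Section LASemigroup.
Variables (S : Type) (op : S -> S -> S).

Local Notation "a ** b" := (op a b) (at level 40, left associativity).

(* Associativity of the operation is not assumed. *)
Definition LA_semigroup : Prop :=
  forall a b c : S, (a ** b) ** c = (c ** b) ** a.

Definition regular : Prop :=
  forall a : S, exists x : S, a = (a ** x) ** a.

Definition setprod (A B : set S) : set S := [set a ** b | a in A & b in B].

(* The empty set is a left and a right ideal under these definitions. *)
Definition right_ideal (I : set S) : Prop := setprod I setT `<=` I.

Definition left_ideal (I : set S) : Prop := setprod setT I `<=` I.

Definition ideal (I : set S) : Prop := right_ideal I /\ left_ideal I.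

(* A prime ideal is not required to be a proper subset; the same holds for
   strongly irreducible ideals. *)
Definition prime_ideal (P : set S) : Prop :=
  ideal P /\
  forall A B : set S, ideal A -> ideal B ->
    setprod A B `<=` P -> A `<=` P \/ B `<=` P.

Definition strongly_irreducible (I : set S) : Prop :=
  ideal I /\
  forall H K : set S, ideal H -> ideal K ->
    H `&` K `<=` I -> H `<=` I \/ K `<=` I.

End LASemigroup.

(* Main.v *)
Require Import Defs.
From mathcomp Require Import all_boot classical_sets.

(** In a regular groupoid the product of two ideals is their intersection, so
    primeness and strong irreducibility impose the same condition on each pair
    of ideals. *)

Local Open Scope classical_set_scope.

(** Absorption puts every product [a b] in both ideals. Conversely, regularity
    factors an element of the intersection as [c = (c x) c], where [c x] stays
    in the first ideal and the last factor [c] is taken in the second. *)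
Lemma setprod_ideals (S : Type) (op : S -> S -> S) (A B : set S) :
  regular op -> right_ideal op A -> left_ideal op B ->
  setprod op A B = A `&` B.
Proof.
move=> S_reg A_right B_left; apply/seteqP; split.
  move=> _ [a Aa [b Bb <-]]; split.
    by apply: A_right; exists a => //; exists b.
  by apply: B_left; exists a => //; exists b.
move=> c [Ac Bc]; have [x c_eq] := S_reg c.
exists (op c x); last by exists c.
by apply: A_right; exists c => //; exists x.
Qed.

Theorem theorem9 (S : Type) (op : S -> S -> S)
    (S_LA : LA_semigroup op) (S_reg : regular op)
    (P : set S) (P_ideal : ideal op P) :
  prime_ideal op P <-> strongly_irreducible op P.
Proof.
have prodE A B : ideal op A -> ideal op B -> setprod op A B = A `&` B.
  by move=> [A_right _] [_ B_left]; apply: setprod_ideals.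
split=> -[_ P_split]; split=> // A B A_ideal B_ideal sub_P;
  by apply: P_split; rewrite // ?prodE // -prodE.
Qed.
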